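(* Let $\mathcal{X}=X_\bullet$ be a $2$-truncated simplicial set with face maps $d_i^q$ and degeneracy maps $s_i^q$. Let $\eta:\bullet\to X_1$ be the morphism in $\mathbf{Span}$ represented by the span $\bullet\leftarrow X_0\xrightarrow{s_0^0}X_1$, and let $\mu:X_1\times X_1\to X_1$ be the morphism in $\mathbf{Span}$ represented by the span $X_1\times X_1\xleftarrow{(d_2^2,d_0^2)}X_2\xrightarrow{d_1^2}X_1$. Then $(X_1,\eta,\mu)$ is a monoid in $\mathbf{Span}$ if and only if both of the following hold: (A) for all $\zeta\in X_2$: (1) if $d_2^2\zeta\in\operatorname{im}(s_0^0)$, then $\zeta\in\operatorname{im}(s_0^1)$; and (2) if $d_0^2\zeta\in\operatorname{im}(s_0^0)$, then $\zeta\in\operatorname{im}(s_1^1)$; (B) there exists a bijection $\Phi:T_{02}\mathcal{X}\to T_{13}\mathcal{X}$ such that $\partial_{13}\circ\Phi=\partial_{02}$.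
   Context: Spans. A span from a set $X$ to a set $Y$ is a triple $(A,f_1,f_2)$ with $A$ a set and maps $f_1:A\to X$, $f_2:A\to Y$. Two spans $(A,f_1,f_2)$, $(A',f_1',f_2')$ from $X$ to $Y$ are isomorphic if there is a bijection $\phi:A\to A'$ with $f_1'\phi=f_1$, $f_2'\phi=f_2$. The category $\mathbf{Span}$ has sets as objects and isomorphism classes of spans as morphisms; the composite of $(A,f_1,f_2)$ from $X$ to $Y$ followed by $(B,g_1,g_2)$ from $Y$ to $Z$ is the pullback $\{(a,b)\in A\times B: f_2(a)=g_1(b)\}$ with maps $(a,b)\mapsto f_1(a)$ and $(a,b)\mapsto g_2(b)$. The identity $\mathbf{1}$ of $X$ is represented by $(X,\mathrm{id},\mathrm{id})$. $\mathbf{Span}$ is monoidal under Cartesian product (of sets and of spans), with unit object a one-point set $\bullet$; the canonical identifications $(X\times Y)\times Z=X\times(Y\times Z)$, $\bullet\times X=X=X\times\bullet$ are used implicitly. A monoid in $\mathbf{Span}$ is a set $X$ with morphisms $\eta:\bullet\to X$ and $\mu:X\times X\to X$ in $\mathbf{Span}$ such that $\mu\circ(\mathbf{1}\times\eta)=\mu\circ(\eta\times\mathbf{1})=\mathbf{1}$ (unit axiom) and $\mu\circ(\mathbf{1}\times\mu)=\mu\circ(\mu\times\mathbf{1})$ (associativity). A $2$-truncated simplicial set consists of sets $X_0,X_1,X_2$, face maps $d_i^q:X_q\to X_{q-1}$ ($0\le i\le q$, $q=1,2$) and degeneracy maps $s_i^q:X_q\to X_{q+1}$ ($0\le i\le q$,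 $q=0,1$) satisfying, whenever both sides are defined, $d_i^{q-1}d_j^q=d_{j-1}^{q-1}d_i^q$ for $i<j$; $s_i^{q+1}s_j^q=s_{j+1}^{q+1}s_i^q$ for $i\le j$; and $d_i^{q+1}s_j^q=s_{j-1}^{q-1}d_i^q$ for $i<j$, $=\mathrm{id}$ for $i\in\{j,j+1\}$, $=s_j^{q-1}d_{i-1}^q$ for $i>j+1$. Tacos. $T_{02}\mathcal{X}=\{(\zeta,\zeta')\in X_2\times X_2: d_1^2\zeta=d_0^2\zeta'\}$ and $T_{13}\mathcal{X}=\{(\zeta,\zeta')\in X_2\times X_2: d_2^2\zeta=d_1^2\zeta'\}$. Let $S\mathcal{X}\subseteq (X_1)^4$ be the set of $(x_{01},x_{12},x_{23},x_{03})$ with $d_0^1x_{01}=d_1^1x_{12}$, $d_0^1x_{12}=d_1^1x_{23}$, $d_0^1x_{23}=d_0^1x_{03}$, $d_1^1x_{03}=d_1^1x_{01}$. The boundary maps $\partial_{02}:T_{02}\mathcal{X}\to S\mathcal{X}$ and $\partial_{13}:T_{13}\mathcal{X}\to S\mathcal{X}$ are $\partial_{02}(\zeta,\zeta')=(d_2^2\zeta',d_2^2\zeta,d_0^2\zeta,d_1^2\zeta')$ and $\partial_{13}(\zeta,\zeta')=(d_2^2\zeta',d_0^2\zeta',d_0^2\zeta,d_1^2\zeta)$. *)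

(* Defs.v *)
From mathcomp Require Import all_boot.
From mathcomp Require Import boolp classical_sets.

Set Implicit Arguments.
Unset Strict Implicit.
Unset Printing Implicit Defensive.

Local Open Scope classical_set_scope.

Record span (X Y : Type) := Span {
  apex : Type;
  src : apex -> X;
  tgt : apex -> Y }.

Definition span_iso (X Y : Type) (A A' : span X Y) : Prop :=
  exists phi : apex A -> apex A',
    [/\ bijective phi, src (s := A') \o phi =1 src (s := A)
      & tgt (s := A') \o phi =1 tgt (s := A)].

(* A from X to Y, followed by B from Y to Z *)
Definition span_comp (X Y Z : Type) (A : span X Y) (B : span Y Z) : span X Z :=
  @Span X Z {p : apex A * apex B | tgt p.1 = src p.2}
    (fun p => src (sval p).1) (fun p => tgt (sval p).2).

Definition span_prod (X X' Y Y' : Type) (A : span X Y) (A' : span X' Y') :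
    span (X * X') (Y * Y') :=
  @Span (X * X') (Y * Y') (apex A * apex A')
    (fun p => (src p.1, src p.2)) (fun p => (tgt p.1, tgt p.2)).

Definition span_fun (X Y : Type) (f : X -> Y) : span X Y :=
  @Span X Y X id f.

Definition span_id (X : Type) : span X X := span_fun id.

Lemma span_iso_refl (X Y : Type) (A : span X Y) : span_iso A A.
Proof. by exists id; split=> //; exists id. Qed.

Lemma span_iso_sym (X Y : Type) (A B : span X Y) :
  span_iso A B -> span_iso B A.
Proof.
case=> phi [[psi phiK psiK] hs ht]; exists psi; split; first by exists phi.
- by move=> b /=; rewrite -hs /= psiK.
- by move=> b /=; rewrite -ht /= psiK.
Qed.

Lemma span_iso_trans (X Y : Type) (A B C : span X Y) :
  span_iso A B -> span_iso B C -> span_iso A C.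
Proof.
case=> f [bf sf tf] [g [bg sg tg]]; exists (g \o f).
split; first exact: bij_comp.
- by move=> a; rewrite -sf /= -sg.
- by move=> a; rewrite -tf /= -tg.
Qed.

Lemma span_comp_iso (X Y Z : Type) (A A' : span X Y) (B B' : span Y Z) :
  span_iso A A' -> span_iso B B' ->
  span_iso (span_comp A B) (span_comp A' B').
Proof.
case=> f [[f' fK f'K] sf tf] [g [[g' gK g'K] sg tg]].
have h (p : apex (span_comp A B)) :
  tgt (f (sval p).1) = src (g (sval p).2).
  by have /= -> := tf (sval p).1; have /= -> := sg (sval p).2; case: p.
have h' (p : apex (span_comp A' B')) :
  tgt (f' (sval p).1) = src (g' (sval p).2).
  rewrite -tf -sg /= f'K g'K; exact: (svalP p).
exists (fun p => exist _ (f (sval p).1, g (sval p).2) (h p)); split.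
- exists (fun p => exist _ (f' (sval p).1, g' (sval p).2) (h' p)).
  + by move=> [[a b] e]; apply: eq_exist; rewrite /= fK gK.
  + by move=> [[a b] e]; apply: eq_exist; rewrite /= f'K g'K.
- by move=> p; apply: sf.
- by move=> p; apply: tg.
Qed.

Lemma span_prod_iso (X X' Y Y' : Type) (A B : span X Y) (A' B' : span X' Y') :
  span_iso A B -> span_iso A' B' ->
  span_iso (span_prod A A') (span_prod B B').
Proof.
case=> f [[f' fK f'K] sf tf] [g [[g' gK g'K] sg tg]].
exists (fun p => (f p.1, g p.2)); split.
- by exists (fun p => (f' p.1, g' p.2)) => -[a b] /=;
    rewrite ?fK ?gK ?f'K ?g'K.
- by move=> [a b]; congr pair; [apply: sf | apply: sg].
- by move=> [a b]; congr pair; [apply: tf | apply: tg].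
Qed.

Record hom (X Y : Type) := Hom {
  hom_class : set (span X Y);
  hom_classP : exists A, hom_class = [set B | span_iso A B] }.

Lemma hom_eq (X Y : Type) (F G : hom X Y) :
  hom_class F = hom_class G -> F = G.
Proof.
case: F G => [c p] [d q] /= e; rewrite -{d}e in q *.
by rewrite (Prop_irrelevance p q).
Qed.

Definition mor (X Y : Type) (A : span X Y) : hom X Y :=
  @Hom X Y [set B | span_iso A B] (ex_intro _ A erefl).

Lemma mor_eq (X Y : Type) (A B : span X Y) : mor A = mor B <-> span_iso A B.
Proof.
split=> [/(congr1 (@hom_class X Y)) /= e | AB].
  suff : [set C | span_iso A C] B by [].
  by rewrite e; apply: span_iso_refl.
apply: hom_eq; apply/seteqP; split=> C /=; apply: span_iso_trans => //.
exact: span_iso_sym.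
Qed.

Lemma hom_compP (X Y Z : Type) (G : hom Y Z) (F : hom X Y) :
  exists C0, [set C | exists A B, [/\ hom_class F A, hom_class G B
      & span_iso (span_comp A B) C]] = [set C | span_iso C0 C].
Proof.
have [A ->] := hom_classP F; have [B ->] := hom_classP G; exists (span_comp A B).
apply/seteqP; split=> C /=.
  by case=> A' [B' [AA' BB' h]]; apply: span_iso_trans h; apply: span_comp_iso.
by move=> h; exists A, B; split=> //; apply: span_iso_refl.
Qed.

(* the composite "G after F" *)
Definition hom_comp (X Y Z : Type) (G : hom Y Z) (F : hom X Y) : hom X Z :=
  Hom (hom_compP G F).

Lemma hom_comp_mor (X Y Z : Type) (B : span Y Z) (A : span X Y) :
  hom_comp (mor B) (mor A) = mor (span_comp A B).
Proof.
apply: hom_eq; apply/seteqP; split=> C /=.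
  by case=> A' [B' [AA' BB' h]]; apply: span_iso_trans h; apply: span_comp_iso.
by move=> h; exists A, B; split=> //; apply: span_iso_refl.
Qed.

Lemma hom_prodP (X X' Y Y' : Type) (F : hom X Y) (G : hom X' Y') :
  exists C0, [set C | exists A B, [/\ hom_class F A, hom_class G B
      & span_iso (span_prod A B) C]] = [set C | span_iso C0 C].
Proof.
have [A ->] := hom_classP F; have [B ->] := hom_classP G; exists (span_prod A B).
apply/seteqP; split=> C /=.
  by case=> A' [B' [AA' BB' h]]; apply: span_iso_trans h; apply: span_prod_iso.
by move=> h; exists A, B; split=> //; apply: span_iso_refl.
Qed.

Definition hom_prod (X X' Y Y' : Type) (F : hom X Y) (G : hom X' Y') :
    hom (X * X') (Y * Y') :=
  Hom (hom_prodP F G).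

Lemma hom_prod_mor (X X' Y Y' : Type) (A : span X Y) (B : span X' Y') :
  hom_prod (mor A) (mor B) = mor (span_prod A B).
Proof.
apply: hom_eq; apply/seteqP; split=> C /=.
  by case=> A' [B' [AA' BB' h]]; apply: span_iso_trans h; apply: span_prod_iso.
by move=> h; exists A, B; split=> //; apply: span_iso_refl.
Qed.

Definition hom_id (X : Type) : hom X X := mor (span_id X).

(* The canonical identifications X = X * unit, X = unit * X and
   (X * Y) * Z = X * (Y * Z), as (invertible) morphisms of spans. *)
Definition runit (X : Type) : hom X (X * unit) :=
  mor (span_fun (fun x : X => (x, tt))).

Definition lunit (X : Type) : hom X (unit * X) :=
  mor (span_fun (fun x : X => (tt, x))).

Definition assoc (X Y Z : Type) : hom (X * Y * Z) (X * (Y * Z)) :=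
  mor (span_fun (fun p : X * Y * Z => (p.1.1, (p.1.2, p.2)))).

Record is_monoid (X : Type) (eta : hom unit X) (mu : hom (X * X) X) : Prop :=
  IsMonoid {
    monoid_unitr :
      hom_comp (hom_comp mu (hom_prod (hom_id X) eta)) (runit X) = hom_id X;
    monoid_unitl :
      hom_comp (hom_comp mu (hom_prod eta (hom_id X))) (lunit X) = hom_id X;
    monoid_assoc :
      hom_comp (hom_comp mu (hom_prod (hom_id X) mu)) (assoc X X X)
      = hom_comp mu (hom_prod mu (hom_id X)) }.

(* dq_i and sq_i stand for d_i^q : X_q -> X_(q-1) and s_i^q : X_q -> X_(q+1). *)
Record sset2 := SSet2 {
  X0 : Type;
  X1 : Type;
  X2 : Type;
  d1_0 : X1 -> X0;
  d1_1 : X1 -> X0;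
  d2_0 : X2 -> X1;
  d2_1 : X2 -> X1;
  d2_2 : X2 -> X1;
  s0_0 : X0 -> X1;
  s1_0 : X1 -> X2;
  s1_1 : X1 -> X2;
  d0d1 : forall z, d1_0 (d2_1 z) = d1_0 (d2_0 z);
  d0d2 : forall z, d1_0 (d2_2 z) = d1_1 (d2_0 z);
  d1d2 : forall z, d1_1 (d2_2 z) = d1_1 (d2_1 z);
  s0s0 : forall v, s1_0 (s0_0 v) = s1_1 (s0_0 v);
  d0s0_0 : forall v, d1_0 (s0_0 v) = v;
  d1s0_0 : forall v, d1_1 (s0_0 v) = v;
  d0s0_1 : forall x, d2_0 (s1_0 x) = x;
  d1s0_1 : forall x, d2_1 (s1_0 x) = x;
  d2s0_1 : forall x, d2_2 (s1_0 x) = s0_0 (d1_1 x);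
  d0s1_1 : forall x, d2_0 (s1_1 x) = s0_0 (d1_0 x);
  d1s1_1 : forall x, d2_1 (s1_1 x) = x;
  d2s1_1 : forall x, d2_2 (s1_1 x) = x }.

Definition T02 (X : sset2) : Type :=
  {t : X2 X * X2 X | d2_1 t.1 = d2_0 t.2}.

Definition T13 (X : sset2) : Type :=
  {t : X2 X * X2 X | d2_2 t.1 = d2_1 t.2}.

(* (x01, x12, x23, x03) *)
Definition is_square (X : sset2) (x : X1 X * X1 X * X1 X * X1 X) : Prop :=
  let: (x01, x12, x23, x03) := x in
  [/\ d1_0 x01 = d1_1 x12, d1_0 x12 = d1_1 x23,
      d1_0 x23 = d1_0 x03 & d1_1 x03 = d1_1 x01].

Definition SX (X : sset2) : Type :=
  {x : X1 X * X1 X * X1 X * X1 X | is_square x}.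

Lemma bd02P (X : sset2) (t : T02 X) :
  is_square (d2_2 (sval t).2, d2_2 (sval t).1, d2_0 (sval t).1, d2_1 (sval t).2).
Proof.
case: t => -[z z'] /= e; split.
- by rewrite d0d2 -e d1d2.
- exact: d0d2.
- by rewrite d0d1 -e d0d1.
- by rewrite d1d2.
Qed.

Definition bd02 (X : sset2) (t : T02 X) : SX X := exist _ _ (bd02P t).

Lemma bd13P (X : sset2) (t : T13 X) :
  is_square (d2_2 (sval t).2, d2_0 (sval t).2, d2_0 (sval t).1, d2_1 (sval t).1).
Proof.
case: t => -[z z'] /= e; split.
- exact: d0d2.
- by rewrite -d0d2 e d0d1.
- by rewrite d0d1.
- by rewrite d1d2 -e d1d2.
Qed.

Definition bd13 (X : sset2) (t : T13 X) : SX X := exist _ _ (bd13P t).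

Definition sset2_eta (X : sset2) : hom unit (X1 X) :=
  mor (@Span unit (X1 X) (X0 X) (fun=> tt) (@s0_0 X)).

Definition sset2_mu (X : sset2) : hom (X1 X * X1 X) (X1 X) :=
  mor (@Span (X1 X * X1 X) (X1 X) (X2 X) (fun z => (d2_2 z, d2_0 z)) (@d2_1 X)).

(* Main.v *)
Require Import Defs.
From mathcomp Require Import all_boot.
From mathcomp Require Import boolp classical_sets.

(** Each of the three monoid axioms asserts that two spans are isomorphic, and
    each of these spans has a readable model.

    The apex of the composite [mu (1 x eta)] consists of the 2-simplices whose
    0-th face is degenerate, mapped to the set of edges by [d2_2] and [d2_1].
    A span is isomorphic to the identity exactly when its two legs agree and
    are bijective ([span_iso_idP]).  The degenerate simplices [s1_1 x] already
    give a section of the left leg, so bijectivity says that the apex holds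
    nothing but degenerate simplices, which is condition (A2).  The other unit
    axiom is the same statement with [d2_0], [d2_2] and [s1_0], [s1_1]
    exchanged; both are instances of [unit_spanP].

    The apexes of [mu (1 x mu)] and [mu (mu x 1)] are pairs of 2-simplices
    glued along an edge, that is, the tacos T02 and T13.  The legs of the two
    composites together record the four outer edges of a taco, that is, its
    boundary ([assoc_l_taco], [assoc_r_taco]).  An isomorphism between the two
    spans is therefore a bijection between tacos preserving boundaries, which
    is condition (B). *)

(** Composing with a bijection on the source side only relabels the left leg:
    this is how the implicit identifications of products are removed. *)
Lemma span_comp_fun_bij (X Y Z : Type) (f : X -> Y) (g : Y -> X)
    (B : span Y Z) : cancel f g -> cancel g f ->
  span_iso (span_comp (span_fun f) B)
           (@Span X Z (apex B) (g \o src (s := B)) (tgt (s := B))).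
Proof.
move=> fK gK; exists (fun p => (sval p).2); split=> //.
- exists (fun b => exist _ (g (src b), b) (gK (src b))) => //.
  by move=> [[x b] /= e]; apply: eq_exist; rewrite /= -e fK.
- by move=> [[x b] /= e]; rewrite -e fK.
Qed.

Lemma span_iso_idP (X : Type) (A : span X X) :
  span_iso A (span_id X) <->
  bijective (src (s := A)) /\ src (s := A) =1 tgt (s := A).
Proof.
split=> [[phi [phi_bij phis phit]] | [src_bij st]].
  split; first exact: eq_bij phi_bij _ phis.
  by move=> a; rewrite -phis -phit.
by exists (src (s := A)); split=> // a; rewrite -st.
Qed.

(** The common form of the two unit axioms.  Here [e] is the unit, [g] the face
    required to be a unit, [f] the opposite face, [h] the product and [s] the
    degeneracy.  Since [s] maps into the apex and is a section of the left leg
    [f], this leg is bijective exactly when [s] exhausts the apex, and then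
    both legs are inverse to [s]. *)
Lemma unit_spanP (V X Z : Type) (e : V -> X) (f g h : Z -> X)
    (s : X -> Z) (v : X -> V) :
  injective e -> cancel s f -> cancel s h -> (forall x, g (s x) = e (v x)) ->
  span_iso (@Span X X {p : V * Z | e p.1 = g p.2}
              (fun p => f (sval p).2) (fun p => h (sval p).2)) (span_id X)
  <-> (forall z, range e (g z) -> range s z).
Proof.
move=> e_inj sf sh gs; apply: iff_trans (span_iso_idP _ _) _ => /=.
pose sec x : {p : V * Z | e p.1 = g p.2} := exist _ (v x, s x) (esym (gs x)).
split=> [[f_bij _] z [w _ ew] | s_onto].
  exists (f z) => //.
  pose p : {p : V * Z | e p.1 = g p.2} := exist _ (w, z) ew.
  have /(bij_inj f_bij) : f (sval (sec (f z))).2 = f (sval p).2 by rewrite /= sf.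
  by move/(congr1 (fun p => (sval p).2)).
have sfK (p : {p : V * Z | e p.1 = g p.2}) : s (f (sval p).2) = (sval p).2.
  have [x _ <-] : range s (sval p).2; last by rewrite sf.
  by apply: s_onto; exists (sval p).1 => //; exact: (svalP p).
split=> [|p]; last by rewrite -{2}sfK sh.
exists sec => [p | x]; last by rewrite /= sf.
move: (sfK p); case: p => -[w z] /= ew sfz; apply: eq_exist; rewrite /= sfz.
by congr pair; apply: e_inj; rewrite -gs sfz.
Qed.

(** A point of the composite is an edge, a vertex and a 2-simplex; the matching
    condition forces the edge to be the face [d2_2] of the simplex, which leaves
    the pairs of [unit_spanP]. *)
Lemma unitr_axiomP (X : sset2) :
  hom_comp (hom_comp (sset2_mu X) (hom_prod (hom_id (X1 X)) (sset2_eta X)))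
    (runit (X1 X)) = hom_id (X1 X)
  <-> (forall z : X2 X, range (@s0_0 X) (d2_0 z) -> range (@s1_1 X) z).
Proof.
rewrite hom_prod_mor !hom_comp_mor mor_eq.
apply: iff_trans (unit_spanP _ _ _ _ _ _ _ _ _ (can_inj (@d0s0_0 X)) (@d2s1_1 X)
  (@d1s1_1 X) (@d0s1_1 X)).
set A := span_comp _ _; set B := Span _ _.
suff AB : span_iso A B.
  split; apply: span_iso_trans => //; exact: span_iso_sym.
apply: span_iso_trans (span_comp_fun_bij _ _ _ _ (fun p => p.1) _ _ _) _ => //.
  by case=> x [].
have AB (p : {p : (X1 X * X0 X) * X2 X
    | (p.1.1, s0_0 p.1.2) = (d2_2 p.2, d2_0 p.2)}) :
  s0_0 (sval p).1.2 = d2_0 (sval p).2 by case: p => p /= [].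
have BA (p : {p : X0 X * X2 X | s0_0 p.1 = d2_0 p.2}) :
  (d2_2 (sval p).2, s0_0 (sval p).1) = (d2_2 (sval p).2, d2_0 (sval p).2).
  by rewrite (svalP p).
exists (fun p => exist _ ((sval p).1.2, (sval p).2) (AB p)); split=> //.
- exists (fun p => exist _ ((d2_2 (sval p).2, (sval p).1), (sval p).2) (BA p)).
  + by move=> [[[x w] z] /= E]; apply: eq_exist; case: E => /= ->.
  + by move=> [[w z] E]; apply: eq_exist.
- by move=> [[[x w] z] /= []].
Qed.

Lemma unitl_axiomP (X : sset2) :
  hom_comp (hom_comp (sset2_mu X) (hom_prod (sset2_eta X) (hom_id (X1 X))))
    (lunit (X1 X)) = hom_id (X1 X)
  <-> (forall z : X2 X, range (@s0_0 X) (d2_2 z) -> range (@s1_0 X) z).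
Proof.
rewrite hom_prod_mor !hom_comp_mor mor_eq.
apply: iff_trans (unit_spanP _ _ _ _ _ _ _ _ _ (can_inj (@d0s0_0 X)) (@d0s0_1 X)
  (@d1s0_1 X) (@d2s0_1 X)).
set A := span_comp _ _; set B := Span _ _.
suff AB : span_iso A B.
  split; apply: span_iso_trans => //; exact: span_iso_sym.
apply: span_iso_trans (span_comp_fun_bij _ _ _ _ (fun p => p.2) _ _ _) _ => //.
  by case=> [[]] x.
have AB (p : {p : (X0 X * X1 X) * X2 X
    | (s0_0 p.1.1, p.1.2) = (d2_2 p.2, d2_0 p.2)}) :
  s0_0 (sval p).1.1 = d2_2 (sval p).2 by case: p => p /= [].
have BA (p : {p : X0 X * X2 X | s0_0 p.1 = d2_2 p.2}) :
  (s0_0 (sval p).1, d2_0 (sval p).2) = (d2_2 (sval p).2, d2_0 (sval p).2).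
  by rewrite (svalP p).
exists (fun p => exist _ ((sval p).1.1, (sval p).2) (AB p)); split=> //.
- exists (fun p => exist _ (((sval p).1, d2_0 (sval p).2), (sval p).2) (BA p)).
  + by move=> [[[w x] z] /= E]; apply: eq_exist; case: E => /= _ ->.
  + by move=> [[w z] E]; apply: eq_exist.
- by move=> [[[w x] z] /= []].
Qed.

(** A family of squares seen as a span from triples of composable edges
    [(x01, x12, x23)] to the closing edge [x03]. *)
Definition square_span (X : sset2) (T : Type) (bd : T -> SX X) :
    span (X1 X * X1 X * X1 X) (X1 X) :=
  @Span _ _ T (fun t => (sval (bd t)).1) (fun t => (sval (bd t)).2).

Lemma square_span_iso (X : sset2) (T T' : Type) (bd : T -> SX X)
    (bd' : T' -> SX X) :
  span_iso (square_span _ _ bd) (square_span _ _ bd') <->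
  exists Phi : T -> T', bijective Phi /\ (forall t, bd' (Phi t) = bd t).
Proof.
split=> [[phi [phi_bij phis phit]] | [phi [phi_bij phib]]]; exists phi.
  split=> // t; move: (phis t) (phit t) => /=.
  case: (bd' _) (bd t) => [[x y] p] [[x' y'] p'] /= exx eyy.
  by apply: eq_exist; rewrite exx eyy.
by split=> // t; rewrite /= phib.
Qed.

(** In the apex of the composite the factor [1] contributes an edge that the
    matching condition identifies with a face of the outer simplex; what is
    left of that condition is the gluing condition of a taco. *)
Lemma assoc_l_taco (X : sset2) :
  hom_comp (hom_comp (sset2_mu X) (hom_prod (hom_id (X1 X)) (sset2_mu X)))
    (assoc (X1 X) (X1 X) (X1 X)) = mor (square_span X _ (@bd02 X)).
Proof.
rewrite hom_prod_mor !hom_comp_mor mor_eq.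
apply: span_iso_trans
  (span_comp_fun_bij _ _ _ _ (fun p => (p.1, p.2.1, p.2.2)) _ _ _) _.
- by case=> [[]].
- by case=> ? [].
have AB (p : {p : (X1 X * X2 X) * X2 X
    | (p.1.1, d2_1 p.1.2) = (d2_2 p.2, d2_0 p.2)}) :
  d2_1 (sval p).1.2 = d2_0 (sval p).2 by case: p => p /= [].
have BA (t : T02 X) :
  (d2_2 (sval t).2, d2_1 (sval t).1) = (d2_2 (sval t).2, d2_0 (sval t).2).
  by rewrite (svalP t).
exists (fun p => exist _ ((sval p).1.2, (sval p).2) (AB p)); split=> //.
- exists (fun t => exist _ ((d2_2 (sval t).2, (sval t).1), (sval t).2) (BA t)).
  + by move=> [[[x w] z] /= E]; apply: eq_exist; case: E => /= ->.
  + by move=> [[w z] E]; apply: eq_exist.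
- by move=> [[[x w] z] /= E]; case: E => -> _.
Qed.

(** A taco in T13 lists the outer simplex of the composite first, so the two
    simplices change places. *)
Lemma assoc_r_taco (X : sset2) :
  hom_comp (sset2_mu X) (hom_prod (sset2_mu X) (hom_id (X1 X)))
  = mor (square_span X _ (@bd13 X)).
Proof.
rewrite hom_prod_mor !hom_comp_mor mor_eq.
have AB (p : {p : (X2 X * X1 X) * X2 X
    | (d2_1 p.1.1, p.1.2) = (d2_2 p.2, d2_0 p.2)}) :
  d2_2 (sval p).2 = d2_1 (sval p).1.1 by case: p => p /= [].
have BA (t : T13 X) :
  (d2_1 (sval t).2, d2_0 (sval t).1) = (d2_2 (sval t).1, d2_0 (sval t).1).
  by rewrite (svalP t).
exists (fun p => exist _ ((sval p).2, (sval p).1.1) (AB p)); split=> //.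
- exists (fun t => exist _ (((sval t).2, d2_0 (sval t).1), (sval t).1) (BA t)).
  + by move=> [[[w x] z] /= E]; apply: eq_exist; case: E => /= _ ->.
  + by move=> [[w z] E]; apply: eq_exist.
- by move=> [[[w x] z] /= E]; case: E => _ ->.
Qed.

Theorem theorem3p6 (X : sset2) :
  is_monoid (sset2_eta X) (sset2_mu X) <->
  (forall z : X2 X,
     (range (@s0_0 X) (d2_2 z) -> range (@s1_0 X) z) /\
     (range (@s0_0 X) (d2_0 z) -> range (@s1_1 X) z)) /\
  (exists Phi : T02 X -> T13 X,
     bijective Phi /\ (forall t : T02 X, bd13 (Phi t) = bd02 t)).
Proof.
rewrite -square_span_iso -mor_eq -assoc_l_taco -assoc_r_taco.
split=> [[/unitr_axiomP ur /unitl_axiomP ul as_] | [A as_]].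
  by split=> // z; split; [apply: ul | apply: ur].
by split=> //; [apply/unitr_axiomP | apply/unitl_axiomP] => z; apply A.
Qed.
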